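(* Every polycyclic group is an RP-group.
   Context: A group is polycyclic if it has a finite subnormal series $G=G_0\supset G_1\supset\dots\supset G_n=\{e\}$ (each $G_{i+1}$ normal in $G_i$) with cyclic factors $G_i/G_{i+1}$. For an endomorphism $\phi$ of a group $G$, elements $x,x'\in G$ are $\phi$-conjugate if $x'=gx\phi(g^{-1})$ for some $g\in G$; the equivalence classes are called $\phi$-conjugacy (Reidemeister) classes, and $R(\phi)$ is their number. For an automorphism $\phi$ of $G$, the characteristic function $f:G\to\{0,1\}$ of a $\phi$-conjugacy class is called periodic if there exist a finite group $K$, an automorphism $\phi_K$ of $K$ and an epimorphism $F:G\to K$ such that $F\circ\phi=\phi_K\circ F$ and $f=f_K\circ F$, where $f_K$ is the characteristic function of a subset of $K$. $G$ is an RP-group if for every automorphism $\phi$ of $G$ with $R(\phi)<\infty$ the characteristic functions of all $\phi$-conjugacy classes are periodic. *)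

(* Defs.v *)
From mathcomp Require Import all_boot fingroup.
From mathcomp Require Import boolp classical_sets functions cardinality.

Set Implicit Arguments.
Unset Strict Implicit.
Unset Printing Implicit Defensive.

Local Open Scope classical_set_scope.
Local Open Scope group_scope.

(* Groups are MathComp's [groupType] (possibly infinite); finite ones are
   [finGroupType].  A map preserving products between groups also preserves 1
   and inverses, so [{multiplicative G -> H}] is the type of homomorphisms. *)

Definition normal_in (G : groupType) (N H : set G) : Prop :=
  N `<=` H /\ forall x y, H x -> N y -> N (y ^ x).

Definition coset_in (G : groupType) (x : G) (N : set G) : set G :=
  [set x * y | y in N].

(* For N normal in H, the factor group H / N consists of the cosets of N by
   elements of H, and the powers (g N)^n, n an integer, of the coset g N are the
   cosets g^n N. *)
Definition cyclic_factor (G : groupType) (H N : set G) : Prop :=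
  exists2 g, H g & forall x, H x -> exists n : nat,
    coset_in x N = coset_in (g ^+ n) N \/ coset_in x N = coset_in (g ^- n) N.

Definition polycyclic (G : groupType) : Prop :=
  exists (n : nat) (S : nat -> set G),
    [/\ S 0 = [set: G], S n = [set 1],
        forall i, i <= n -> group_closed (mem (S i))
      & forall i, i < n ->
          normal_in (S i.+1) (S i) /\ cyclic_factor (S i) (S i.+1)].

Definition twisted_conj (G : groupType) (phi : G -> G) (x x' : G) : Prop :=
  exists g, x' = g * x * phi g^-1.

Definition twisted_class (G : groupType) (phi : G -> G) (x : G) : set G :=
  [set x' | twisted_conj phi x x'].

Definition Reidemeister_classes (G : groupType) (phi : G -> G) : set (set G) :=
  range (twisted_class phi).

Definition finite_Reidemeister (G : groupType) (phi : G -> G) : Prop :=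
  finite_set (Reidemeister_classes phi).

(* Characteristic functions are boolean membership tests. *)
Definition periodic_fun (G : groupType) (phi : G -> G) (f : G -> bool) : Prop :=
  exists (K : finGroupType) (phiK : {multiplicative K -> K})
         (F : {multiplicative G -> K}) (A : {set K}),
    [/\ bijective phiK, range F = [set: K], F \o phi =1 phiK \o F
      & f =1 (fun k => k \in A) \o F].

Definition RP_group (G : groupType) : Prop :=
  forall phi : {multiplicative G -> G},
    bijective phi -> finite_Reidemeister phi ->
    forall C, Reidemeister_classes phi C -> periodic_fun phi (fun x => x \in C).

(* Main.v *)
Require Import Defs.
From HB Require Import structures.
From mathcomp Require Import all_boot fingroup morphism quotient.
From mathcomp Require Import boolp classical_sets functions cardinality.

(** The class of [x0] under [phi] is a translate of the class of 1 under
    [phi] followed by conjugation by [x0^-1], because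
    [h * x0 * phi h^-1 = (h * x0 * phi h^-1 * x0^-1) * x0].  So it is enough to
    show that, when [phi] has finitely many twisted classes, the class of 1,
    i.e. the image of the Lang map [delta h = h * phi h^-1], contains a normal
    subgroup of finite index; the class of [x0] is then a union of cosets of
    it.  The subgroups used are the verbal subgroups [V n] generated by the
    [n]-th powers: every endomorphism preserves them, and any subgroup of
    finite index contains one.

    Three facts about a polycyclic group [G] carry the argument.  The subgroups
    [V n] have finite index; every subgroup is closed in the profinite topology
    (Mal'cev); and [G] is solvable.  The first two pass from [N] to [H] when
    [H / N] is cyclic ([tame_cyclic_ext]), the third one holds because each
    term of the polycyclic series contains the corresponding derived subgroup.

    Descend along the derived series, carrying for each term [D] two
    properties: the fixed points of [phi] on [G / D] are finite in number
    ([finite_fixed D]), and the Lang map of [G / D] is open at 1 for the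
    profinite topology ([open_orbits D]).  Let [A] and [C] be consecutive
    terms.
    - Finitely many classes of [V k] meet [A].  Up to the finitely many fixed
      points on [G / A], two elements of [A] in one such class differ, modulo
      [C], by the Lang map of an element of [A :&: V k].  So the image of
      [A :&: V k] in [A / C] has finite index ([fin_index_lang_image]).
    - On the abelian group [A / C] the Lang map is an endomorphism.  In a finite
      quotient its kernel is as large as its cokernel, and the cokernel is
      bounded, hence by separability the kernel is finite
      ([lang_kernel_finite]).  This gives [finite_fixed C].
    - As that image is profinitely open in [A], a remainder [a \in A] in
      [x = delta h * a] with [x] and [h] small is itself [delta b] modulo [C]
      with [b] small, which gives [open_orbits C] ([open_orbits_step]).
    At the end of the series [open_orbits] says that the image of the Lang map
    contains some [V n], and [phi] induces the required automorphism of the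
    finite group [G / V n]. *)

Set Implicit Arguments.
Unset Strict Implicit.
Unset Printing Implicit Defensive.

Local Open Scope classical_set_scope.
Local Open Scope group_scope.

(** * Finite covers *)

(** [R] is an arbitrary relation, so that covers can be refined without
    checking symmetry or transitivity. *)
Definition finite_mod (T : eqType) (P : set T) (R : T -> T -> Prop) : Prop :=
  exists s : seq T, (forall y, y \in s -> P y) /\
    forall x, P x -> exists2 y, y \in s & R y x.

(** Pigeonhole with keys in a finite list: choose one element of [Q] for each
    key that occurs.  The keys need not lie in [Q], which is how finiteness
    passes to subsets. *)
Lemma finite_mod_key (T U : eqType) (s : seq T) (Q : set U)
    (R : T -> U -> Prop) (R2 : U -> U -> Prop) :
  (forall u, Q u -> exists2 y, y \in s & R y u) ->
  (forall y u v, y \in s -> Q u -> Q v -> R y u -> R y v -> R2 u v) ->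
  finite_mod Q R2.
Proof.
elim: s Q => [|y s IHs] Q cov key.
  by exists [::]; split=> // x /cov[].
have [s2 [s2Q s2cov]] : finite_mod [set u | Q u /\ ~ R y u] R2.
  apply: IHs => [u [Qu nRu] | z u v zs [Qu _] [Qv _]].
    by have [z] := cov u Qu; rewrite inE => /orP[/eqP -> // | zs Rzu]; exists z.
  by apply: key => //; rewrite inE zs orbT.
have [[x0 [Qx0 Rx0]] | no] := pselect (exists x, Q x /\ R y x).
  exists (x0 :: s2); split=> [z|x Qx].
    by rewrite inE => /orP[/eqP -> // | /s2Q[]].
  have [Rx | nRx] := pselect (R y x).
    by exists x0; [exact: mem_head | apply: (key y); rewrite ?mem_head].
  by have [|z zs Rzx] := s2cov x; [split | exists z; rewrite // inE zs orbT].
exists s2; split=> [z /s2Q[] // | x Qx].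
by apply: s2cov; split=> // Rx; apply: no; exists x.
Qed.

Lemma finite_mod_refine (T : eqType) (P : set T) (R1 R2 : T -> T -> Prop) :
  finite_mod P R1 ->
  (forall y, P y -> finite_mod [set x | P x /\ R1 y x] R2) ->
  finite_mod P R2.
Proof.
case=> s [sP scov] fib.
suff [s2 [s2P s2cov]] : exists s2 : seq T, (forall y, y \in s2 -> P y) /\
    forall x, P x -> (exists2 y, y \in s & R1 y x) ->
    exists2 y, y \in s2 & R2 y x.
  by exists s2; split=> // x Px; apply: s2cov => //; apply: scov.
elim: s sP {scov} => [|y s IHs] sP; first by exists [::]; split=> // x _ [].
have [|s2 [s2P s2cov]] := IHs; first by move=> z zs; apply: sP; rewrite inE zs orbT.
have [s1 [s1P s1cov]] := fib y (sP y (mem_head _ _)).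
exists (s1 ++ s2); split=> [z|x Px [z]].
  by rewrite mem_cat => /orP[/s1P[] | /s2P].
rewrite inE => /orP[/eqP -> Rx | zs Rx].
  by have [|w ws] := s1cov x; [split | exists w; rewrite // mem_cat ws].
have [|w ws Rw] := s2cov x Px; first by exists z.
by exists w; rewrite // mem_cat ws orbT.
Qed.

(** A longest list without repetitions modulo [R] is a cover. *)
Lemma finite_mod_bounded (T : eqType) (P : set T) (R : T -> T -> Prop) m :
  (forall s : seq T, (forall x, x \in s -> P x) ->
    pairwise (fun x y => `[< ~ R y x >]) s -> size s <= m) ->
  finite_mod P R.
Proof.
move=> bound; apply: contrapT => nfin.
suff [s [sP pws size_s]] : exists s : seq T, [/\ forall x, x \in s -> P x,
    pairwise (fun x y => `[< ~ R y x >]) s & size s = m.+1].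
  by have := bound s sP pws; rewrite size_s ltnn.
elim: m.+1 => [|n [s [sP pws size_s]]]; first by exists [::].
apply: contrapT => noext; apply: nfin; exists s; split=> // x Px.
apply: contrapT => ncov; apply: noext; exists (x :: s); split=> [y||] /=.
- by rewrite inE => /orP[/eqP -> // | /sP].
- rewrite pws andbT; apply/allP => y ys; apply/asboolP => Ryx.
  by apply: ncov; exists y.
- by rewrite size_s.
Qed.

(** * Subgroups, indices and verbal subgroups *)
Section Subgroups.

Variable G : groupType.
Implicit Types (H N C D W : set G) (x y t : G).

Record subgroup H : Prop := Subgroup {
  subg1 : H 1;
  subgM : forall x y, H x -> H y -> H (x * y);
  subgV : forall x, H x -> H x^-1 }.

Definition normalises H N : Prop := forall h x, H h -> N x -> N (x ^ h).

Definition prod_set C N : set G := [set c * n | c in C & n in N].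

(** The covering cosets are the right cosets [D :* x]. *)
Definition fin_index D H : Prop := finite_mod H (fun x y => D (y * x^-1)).

Lemma subgX H x n : subgroup H -> H x -> H (x ^+ n).
Proof.
move=> sH Hx; elim: n => [|n IHn]; first exact: subg1.
by rewrite expgS; apply: subgM.
Qed.

Lemma subgMr H x y : subgroup H -> H y -> H (x * y) <-> H x.
Proof.
move=> sH Hy; split=> [Hxy|Hx]; last exact: subgM.
by rewrite -(mulgK y x); apply: subgM => //; apply: subgV.
Qed.

Lemma subgMl H x y : subgroup H -> H x -> H (x * y) <-> H y.
Proof.
move=> sH Hx; split=> [Hxy|Hy]; last exact: subgM.
by rewrite -(mulKg x y); apply: subgM => //; apply: subgV.
Qed.

Lemma subgVE H x : subgroup H -> H x^-1 <-> H x.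
Proof. by move=> sH; split=> /(subgV sH); rewrite ?invgK. Qed.

Lemma subgroupI H D : subgroup H -> subgroup D -> subgroup (H `&` D).
Proof.
by move=> [H1 HM HV] [D1 DM DV]; split=> // [x y [? ?] [? ?]|x [? ?]]; split; auto.
Qed.

Lemma subgroupT : subgroup [set: G].
Proof. by []. Qed.

Lemma subgroup_prod C N :
  subgroup C -> subgroup N -> normalises C N -> subgroup (prod_set C N).
Proof.
move=> sC sN nCN; split.
- by exists 1; [exact: subg1 | exists 1; [exact: subg1 | rewrite mulg1]].
- move=> _ _ [c Cc [n Nn <-]] [d Cd [m Nm <-]].
  exists (c * d); first exact: subgM.
  exists (n ^ d * m); first by apply: subgM => //; apply: nCN.
  by rewrite conjgE !mulgA mulgK.
- move=> _ [c Cc [n Nn <-]]; exists c^-1; first exact: subgV.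
  exists (n^-1 ^ c^-1); first by apply: nCN; exact: subgV.
  by rewrite conjgE invgM invgK !mulgA mulVg mul1g.
Qed.

Lemma prod_setl C N x : subgroup N -> C x -> prod_set C N x.
Proof. by move=> sN Cx; exists x => //; exists 1; [exact: subg1 | rewrite mulg1]. Qed.

Lemma prod_setr C N x : subgroup C -> N x -> prod_set C N x.
Proof. by move=> sC Nx; exists 1; [exact: subg1 | exists x; rewrite // mul1g]. Qed.

Lemma prod_set_sub C N D :
  subgroup D -> C `<=` D -> N `<=` D -> prod_set C N `<=` D.
Proof. by move=> sD CD ND _ [c Cc [n Nn <-]]; apply: subgM; auto. Qed.

Inductive gen (S : set G) : set G :=
| sub_gen x : S x -> gen S x
| gen1 : gen S 1
| genM x y : gen S x -> gen S y -> gen S (x * y)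
| genV x : gen S x -> gen S x^-1.

Lemma gen_subgroup S : subgroup (gen S).
Proof. by split; constructor. Qed.

Lemma gen_min S H : subgroup H -> S `<=` H -> gen S `<=` H.
Proof. by move=> [H1 HM HV] SH x; elim=> {x}; auto. Qed.

Lemma gen_hom (f : UMagmaMorphism.type G G) S S' :
  (forall x, S x -> S' (f x)) ->
  forall x, gen S x -> gen S' (f x).
Proof.
move=> fS x; elim=> {x} [x /fS|  |x y _ IHx _ IHy|x _ IHx].
- exact: sub_gen.
- by rewrite gmulf1; constructor.
- by rewrite gmulfM; constructor.
- by rewrite gmulfV; constructor.
Qed.

(** A named function, so that conjugation can carry a morphism structure. *)
Definition conj_by (g x : G) : G := x ^ g.

Lemma conj_by_morph (g : G) : monoid_morphism (conj_by g).
Proof. by split=> [|x y]; [exact: conj1g | exact: conjMg]. Qed.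

HB.instance Definition _ (g : G) :=
  isUMagmaMorphism.Build G G (conj_by g) (conj_by_morph g).

Definition pow n H : set G := gen [set y ^+ n | y in H].

Lemma pow_subgroup n H : subgroup (pow n H).
Proof. exact: gen_subgroup. Qed.

Lemma powX n H x : H x -> pow n H (x ^+ n).
Proof. by move=> Hx; apply: sub_gen; exists x. Qed.

Lemma pow_min n H D :
  subgroup D -> (forall x, H x -> D (x ^+ n)) -> pow n H `<=` D.
Proof. by move=> sD HD; apply: gen_min => // _ [x Hx <-]; apply: HD. Qed.

Lemma pow_hom (f : UMagmaMorphism.type G G) n H H' :
  (forall x, H x -> H' (f x)) -> forall x, pow n H x -> pow n H' (f x).
Proof.
move=> fH; apply: gen_hom => _ [x Hx <-]; rewrite gmulfXn.
by exists (f x) => //; apply: fH.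
Qed.

Lemma pow_sub n H : subgroup H -> pow n H `<=` H.
Proof. by move=> sH; apply: pow_min => // x; apply: subgX. Qed.

Lemma pow_normal H N n : normalises H N -> normalises H (pow n N).
Proof.
move=> nHN h x Hh; apply: (@pow_hom (conj_by h)) => y; exact: nHN.
Qed.

Lemma pow_mulr m n H : pow (n * m)%N H `<=` pow n H.
Proof.
apply: pow_min; first exact: pow_subgroup.
by move=> x Hx; rewrite expgnA; exact: (subgX m (pow_subgroup n H) (powX n Hx)).
Qed.

Lemma pow_mull m n H : pow (m * n)%N H `<=` pow n H.
Proof. by rewrite mulnC; apply: pow_mulr. Qed.

(** Among the powers [y ^+ 0, ..., y ^+ m], with [m] the number of cosets, two
    share a coset, so some [y ^+ k] with [0 < k <= m] is in [D], and then
    [y ^+ m`!] is.  Thus the [pow n H] are cofinal among the finite index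
    subgroups of [H]. *)
Lemma fin_index_exponent D H : subgroup D -> subgroup H -> fin_index D H ->
  exists2 n, 0 < n & pow n H `<=` D.
Proof.
move=> sD sH [s [sHs scov]]; exists (size s)`!; first exact: fact_gt0.
apply: pow_min => // y Hy.
have /choice[r rP] : forall i, exists z, z \in s /\ D (y ^+ i * z^-1).
  by move=> i; have [|z] := scov (y ^+ i); [exact: subgX | exists z].
have /(uniqPn 1)[i [j [lt_ij]]] : ~~ uniq (mkseq r (size s).+1).
  apply/negP => /uniq_leq_size-/(_ s); rewrite size_mkseq ltnn => h.
  by apply: (notF (h _)) => _ /mapP[k _ ->]; case: (rP k).
rewrite size_mkseq => lt_js; rewrite !nth_mkseq // ?(ltn_trans lt_ij) // => eq_r.
have Dij : D (y ^+ (j - i)).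
  rewrite expgnFr ?(ltnW lt_ij) // -(mulgKA (r i)^-1) [in X in X * _]eq_r.
  by apply: subgM => //; [case: (rP j) | apply: subgV => //; case: (rP i)].
have /dvdnP[q ->] : (j - i %| (size s)`!)%N.
  by apply: dvdn_fact; rewrite subn_gt0 lt_ij leq_subLR (leq_trans _ (leq_addl _ _)).
by rewrite mulnC expgnA; apply: subgX.
Qed.

(** For a coset [D K x], with [K] covered by cosets [W u], the cosets
    [D W u x] suffice because [d (w u) x] is in [(D W) (u x)]. *)
Lemma fin_index_prod D H K W : subgroup D -> subgroup W ->
  normalises H W -> D `<=` H -> fin_index (prod_set D K) H -> fin_index W K ->
  fin_index (prod_set D W) H.
Proof.
move=> sD sW nW DH finDK [s [sK scov]].
apply: (finite_mod_refine finDK) => x Hx.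
have sDW : subgroup (prod_set D W) by apply: subgroup_prod => // d w /DH; apply: nW.
apply: (@finite_mod_key _ _ s _ (fun u y => prod_set D W (y * (u * x)^-1))).
  move=> y [Hy [d Dd [k Kk eq_y]]].
  have [u us Wku] := scov k Kk; exists u => //.
  exists d => //; exists (k * u^-1) => //.
  by rewrite invgM mulgA mulgA eq_y.
move=> u y z _ _ _ DWy DWz.
by rewrite -(mulgKA (u * x)^-1 z y); apply: subgM => //; apply: subgV.
Qed.

(** * Cyclic extensions *)

(** The powers of [t] with integer exponents, an exponent being a difference
    of natural numbers; the subgroup laws then need no case analysis on
    signs. *)
Definition cyc t : set G := [set x | exists a b, x = t ^+ a * t ^- b].

Lemma cyc_subgroup t : subgroup (cyc t).
Proof.
have cX a b : commute (t ^+ a) (t ^- b) by apply: commuteV; apply: commuteX2.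
split=> [|_ _ [a [b ->]] [c [d ->]]|_ [a [b ->]]].
- by exists 0, 0; rewrite !expg0 invg1 mulg1.
- exists (a + c), (b + d); rewrite expgnDr (addnC b) expgnDr invgM !mulgA.
  by congr (_ * _); rewrite -!mulgA; congr (_ * _); rewrite cX.
- by exists b, a; rewrite invgM invgK.
Qed.

Lemma cycX t n : cyc t (t ^+ n).
Proof. by exists n, 0; rewrite expg0 invg1 mulg1. Qed.

Lemma cyc_sub t D : subgroup D -> D t -> cyc t `<=` D.
Proof.
by move=> sD Dt _ [a [b ->]]; apply: subgM => //; last apply: subgV => //; apply: subgX.
Qed.

(** When [D] is normal this says that [t] has infinite order modulo [D]. *)
Definition infinite_mod t D : Prop := forall k, 0 < k -> ~ D (t ^+ k).

Lemma infinite_mod_inj t D :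
  subgroup D -> infinite_mod t D -> injective (fun n => t ^+ n).
Proof.
move=> sD inf m n; wlog le_mn : m n / m <= n.
  by move=> th; case/orP: (leq_total m n) => /th; [apply | move=> h /esym/h].
move=> /= eq_t; apply/eqP; rewrite eqn_leq le_mn leqNgt; apply/negP => lt_mn.
apply: (inf (n - m)); first by rewrite subn_gt0.
by rewrite expgnFr // eq_t mulgV; apply: subg1.
Qed.

Lemma infinite_mod_cyc t D x :
  subgroup D -> infinite_mod t D -> cyc t x -> D x -> x = 1.
Proof.
move=> sD inf [a [b ->]].
case: (ltngtP a b) => [lt_ab|lt_ba|->] Dx; last by rewrite mulgV.
- case: (inf (b - a)); first by rewrite subn_gt0.
  by rewrite expgnFr ?(ltnW lt_ab) // -(subgVE _ sD) invgF.
- by case: (inf (a - b)); [rewrite subn_gt0 | rewrite expgnFr // ltnW].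
Qed.

(** A coset [D t^j] depends only on [j] modulo [k]. *)
Lemma fin_index_cyc t k H N D : subgroup H -> subgroup D ->
  normalises H N -> H t -> H `<=` prod_set (cyc t) N ->
  N `<=` D -> 0 < k -> D (t ^+ k) -> fin_index D H.
Proof.
move=> sH sD nN Ht Hcyc ND k0 Dtk.
apply: (@finite_mod_key _ _ (iota 0 k) _ (fun r x => D (x * t ^- r))); last first.
  move=> r x y _ _ _ Dx Dy.
  by rewrite -(mulgKA (t ^- r) y x); apply: subgM => //; apply: subgV.
move=> x Hx.
suff [j Dj] : exists j, D (x * t ^- j).
  exists (j %% k); first by rewrite mem_iota /= ltn_mod.
  rewrite -(mulgVK (t ^+ (j %/ k * k)%N) (t ^- (j %% k))) -invgM -expgnDr.
  rewrite -divn_eq mulnC expgnA mulgA.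
  by apply: subgM => //; apply: subgX.
have [_ [a [b ->]] [u Nu <-]] := Hcyc x Hx.
set p := t ^+ a * t ^- b.
have Hp : H p by apply: subgM => //; [|apply: subgV => //]; apply: subgX.
(* [t ^- b] is [t ^+ (k.-1 * b)] up to a power of [t ^+ k], which avoids
   negative exponents. *)
exists (k.-1 * b + a)%N.
have -> : p * u * t ^- (k.-1 * b + a)%N = u ^ p^-1 * (t ^+ k) ^- b.
  have cab : commute (t ^+ a) (t ^- b) by apply: commuteV; apply: commuteX2.
  rewrite conjgE invgK -!mulgA; congr (_ * (_ * _)).
  rewrite [p]cab invgM invgK -expgnA -[in RHS](prednK k0) mulSn (addnC b) !expgnDr.
  by rewrite !invgM !mulgA mulgK.
apply: subgM => //; first by apply: ND; apply: nN => //; apply: subgV.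
by apply: subgV => //; apply: subgX.
Qed.

Lemma fin_indexS D D' H : D `<=` D' -> fin_index D H -> fin_index D' H.
Proof.
move=> DD' [s [sH scov]]; exists s; split=> // x /scov[y ys Dyx].
by exists y => //; apply: DD'.
Qed.

(** Every subgroup of [H] is closed in the profinite topology of [H]; by
    [fin_index_exponent] it is enough to test the subgroups [pow n H]. *)
Definition subgroup_separable H : Prop := forall C x,
  subgroup C -> C `<=` H -> H x -> ~ C x ->
  exists2 n, 0 < n & ~ prod_set C (pow n H) x.

(** The two properties are bundled because the proof of separability for an
    extension uses both of them for the kernel. *)
Definition tame H : Prop :=
  [/\ subgroup H, forall n, 0 < n -> fin_index (pow n H) H & subgroup_separable H].

Lemma separable_by D H C x : subgroup H -> subgroup D -> fin_index D H ->
  C `<=` D -> ~ D x -> exists2 n, 0 < n & ~ prod_set C (pow n H) x.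
Proof.
move=> sH sD finD CD nDx; have [n n0 nD] := fin_index_exponent sD sH finD.
by exists n => // /(prod_set_sub sD CD nD).
Qed.

Section CyclicExtension.

Variables (H N : set G) (t : G).
Hypotheses (sH : subgroup H) (NH : N `<=` H) (nHN : normalises H N).
Hypotheses (Ht : H t) (Hcyc : H `<=` prod_set (cyc t) N).

(** The subgroups [D (pow m N)] are the finite index subgroups of [H] through
    which separability in [N] is transferred to [H]. *)
Lemma fin_index_cyclic_ext n D : 0 < n -> subgroup N -> subgroup D -> D `<=` H ->
  prod_set D N (t ^+ n) -> (forall m, 0 < m -> fin_index (pow m N) N) ->
  forall m, 0 < m -> fin_index (prod_set D (pow m N)) H.
Proof.
move=> n0 sN sD DH Dt finN m m0.
apply: (@fin_index_prod _ _ N) => //.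
- exact: pow_subgroup.
- exact: pow_normal.
- apply: (@fin_index_cyc t n _ N) => //.
  + by apply: subgroup_prod => // d x /DH; apply: nHN.
  + by move=> x Nx; apply: prod_setr.
- exact: finN.
Qed.

Lemma fin_index_pow_cyclic_ext n : subgroup N ->
  (forall m, 0 < m -> fin_index (pow m N) N) -> 0 < n -> fin_index (pow n H) H.
Proof.
move=> sN finN n0; have sP := pow_subgroup n H.
apply: fin_indexS (fin_index_cyclic_ext n0 sN sP _ _ finN n0).
- apply: prod_set_sub => //; apply: pow_min => // x /NH; exact: powX.
- exact: pow_sub.
- by apply: prod_setl => //; apply: powX.
Qed.

(** To separate [x] from [C], find a finite index subgroup that contains [C]
    and not [x], or whose trace on [N] is small.  If [C] has finite index
    modulo [N], either [C N] does not contain [x], or [x] can be moved into [N]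
    by an element of [C] and separation in [N] gives [C (pow m N)].  Otherwise
    [t] has infinite order modulo [N] and [C] is contained in [N]; if [x] is in
    [N], use [<t> (pow m N)], which meets [N] in [pow m N], and if not, use
    [<t^n> N] with [n] larger than the exponent of [t] in [x]. *)
Lemma subgroup_separable_cyclic_ext : tame N -> subgroup_separable H.
Proof.
move=> [sN finN sepN] C x sC CH Hx nCx.
have sCN : subgroup (prod_set C N) by apply: subgroup_prod => // d y /CH; apply: nHN.
have nHW m : normalises H (pow m N) by apply: pow_normal.
have sW m := pow_subgroup m N.
have WN m : pow m N `<=` N by apply: pow_sub.
have sepNC y : N y -> ~ C y ->
    exists2 m, 0 < m & forall c w, C c -> N c -> pow m N w -> y <> c * w.
  move=> Ny nCy; have [|||m m0 nm] := sepN (C `&` N) y _ _ Ny.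
  - exact: subgroupI.
  - by move=> c [].
  - by case.
  by exists m => // c w Cc Nc Ww eq_y; apply: nm; exists c; [|exists w].
have [[k [k0 Ctk]]|inf] := pselect (exists k, 0 < k /\ prod_set C N (t ^+ k)).
  have [[c Cc [u Nu eq_x]]|nCNx] := pselect (prod_set C N x); last first.
    apply: (separable_by sH sCN) => //; last by move=> c; apply: prod_setl.
    apply: (@fin_index_cyc t k _ N) => //.
    by move=> y Ny; apply: prod_setr.
  have [|m m0 nm] := sepNC u Nu; first by move=> Cu; apply: nCx; rewrite -eq_x; apply: subgM.
  have sCW : subgroup (prod_set C (pow m N)).
    by apply: subgroup_prod => // d y /CH; apply: nHW.
  apply: (separable_by sH sCW).
  - exact: (fin_index_cyclic_ext k0).
  - by move=> y; apply: prod_setl.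
  rewrite -eq_x => /(subgMl _ sCW (prod_setl (sW m) Cc)) [d Cd [w Ww eq_u]].
  apply: (nm d w) => //; rewrite -(mulgK w d) eq_u; apply: subgM => //.
  by apply: subgV => //; apply: WN Ww.
have {}inf : infinite_mod t (prod_set C N) by move=> k k0 Ctk; apply: inf; exists k.
have infN : infinite_mod t N by move=> k k0 Ntk; apply: (inf k) => //; apply: prod_setr.
have cycN p : cyc t p -> N p -> p = 1 by apply: infinite_mod_cyc.
have CN : C `<=` N.
  move=> c Cc; have [p tp [u Nu eq_c]] := Hcyc (CH c Cc).
  suff p1 : p = 1 by rewrite -eq_c p1 mul1g.
  apply: (infinite_mod_cyc sCN inf tp).
  exists c => //; exists u^-1; first exact: subgV.
  by rewrite -eq_c mulgK.
have [Nx|nNx] := pselect (N x).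
  have [m m0 nm] := sepNC x Nx nCx.
  have sT := cyc_subgroup t; have TH := cyc_sub sH Ht.
  have sTW : subgroup (prod_set (cyc t) (pow m N)).
    by apply: subgroup_prod => // d y /TH; apply: nHW.
  have [|n n0 powTW] := fin_index_exponent sTW sH.
    apply: (@fin_index_cyclic_ext 1) => //.
    by apply: prod_setl => //; apply: cycX.
  exists n => // -[c Cc [v /powTW[p tp [w Ww <-]]]].
  move=> eq_x; have p1 : p = 1.
    apply: cycN => //; rewrite -(mulgK w p).
    apply: subgM => //; last by apply: subgV => //; apply: WN Ww.
    by rewrite -(subgMl _ sN (CN c Cc)) eq_x.
  by apply: (nm c w) => //; [apply: CN | rewrite -eq_x p1 mul1g].
have [p tp [u Nu eq_x]] := Hcyc Hx.
have [a [b eq_p]] := tp; pose n := (a + b).+1.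
have [lt_an lt_bn] : a < n /\ b < n by rewrite !ltnS leq_addr leq_addl.
have n0 : 0 < n by []; clearbody n.
have TH : cyc (t ^+ n) `<=` H by apply: cyc_sub => //; apply: subgX.
have sT := cyc_subgroup (t ^+ n).
have sTN : subgroup (prod_set (cyc (t ^+ n)) N).
  by apply: subgroup_prod => // d y /TH; apply: nHN.
apply: (separable_by sH sTN).
- apply: (@fin_index_cyc t n _ N) => //.
  + by move=> y; apply: prod_setr.
  + by apply: prod_setl => //; rewrite -[t ^+ n]expg1; apply: cycX.
- by move=> c /CN; apply: prod_setr.
move=> [q tq [v Nv eq_qx]]; apply: nNx.
suff p1 : p = 1 by rewrite -eq_x p1 mul1g.
have eq_pq : q = p.
  rewrite -(mulVKg p q) (cycN (p^-1 * q)) ?mulg1 //.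
    have sTt := cyc_subgroup t; apply: subgM => //; first exact: subgV.
    by apply: (cyc_sub sTt _ tq); apply: cycX.
  have -> : p^-1 * q = u * v^-1 by rewrite -(mulgK v q) eq_qx -eq_x !mulgA mulVg mul1g.
  by apply: subgM => //; apply: subgV.
have [c [d]] := tq; rewrite eq_pq eq_p -!expgnA => eq_ab.
have : t ^+ (a + n * d) = t ^+ (b + n * c).
  rewrite (addnC b) !expgnDr -(mulgVK (t ^+ b) (t ^+ a)) eq_ab -mulgA.
  by rewrite -(expgnDr t b) addnC expgnDr mulgA mulgVK -expgnDr addnC expgnDr.
move=> /(infinite_mod_inj sN infN) /(congr1 (modn^~ n)).
rewrite ![(n * _)%N]mulnC ![(_ + _ * n)%N]addnC !modnMDl !modn_small // => eq_ij.
by rewrite eq_ij mulgV.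
Qed.

Lemma tame_cyclic_ext : tame N -> tame H.
Proof.
move=> tN; have [sN finN _] := tN.
by split=> // [n n0|]; [exact: fin_index_pow_cyclic_ext | exact: subgroup_separable_cyclic_ext].
Qed.

End CyclicExtension.

End Subgroups.

(** * The derived series and polycyclic groups *)
Section Derived.

Variable G : groupType.
Implicit Types (H N C D W : set G) (x y t : G).

Definition derived H : set G := gen [set [~ x, y] | x in H & y in H].

Lemma derived_sub H N : subgroup N ->
  (forall x y, H x -> H y -> N [~ x, y]) -> derived H `<=` N.
Proof. by move=> sN NR; apply: gen_min => // _ [x Hx [y Hy <-]]; apply: NR. Qed.

Lemma derived_hom (f : UMagmaMorphism.type G G) H :
  (forall x, H x -> H (f x)) -> forall x, derived H x -> derived H (f x).
Proof.
move=> fH; apply: gen_hom => _ [x Hx [y Hy <-]]; rewrite gmulfR.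
by exists (f x); [apply: fH | exists (f y) => //; apply: fH].
Qed.

Definition dseries n : set G := iter n derived [set: G].

Lemma dseries_subgroup n : subgroup (dseries n).
Proof. by case: n => [|n]; [exact: subgroupT | exact: gen_subgroup]. Qed.

Lemma dseries_hom (f : UMagmaMorphism.type G G) n x : dseries n x -> dseries n (f x).
Proof. elim: n x => // n IHn; exact: derived_hom. Qed.

Lemma dseries_normal n : normalises [set: G] (dseries n).
Proof. by move=> h x _; apply: (@dseries_hom (conj_by h)). Qed.

Lemma dseriesR n x y : dseries n x -> dseries n y -> dseries n.+1 [~ x, y].
Proof. by move=> Dx Dy; apply: sub_gen; exists x => //; exists y. Qed.

Lemma dseriesS n : dseries n.+1 `<=` dseries n.
Proof.
apply: derived_sub => [|x y Dx Dy]; first exact: dseries_subgroup.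
have sD := dseries_subgroup n; rewrite commgEl.
by apply: subgM => //; [exact: subgV | apply: dseries_normal].
Qed.

Lemma tame1 : tame [set 1 : G].
Proof.
have s1 : subgroup [set 1 : G].
  by split=> [//|_ _ -> -> /=|_ -> /=]; rewrite ?mulg1 ?invg1.
split=> // [n n0|C x sC _ -> []]; last exact: subg1.
exists [:: 1]; split=> [y|x ->]; first by rewrite inE => /eqP.
by exists 1; rewrite ?mem_head // divg1; apply: subg1; apply: pow_subgroup.
Qed.

Lemma group_closed_subgroup H : group_closed (mem H) -> subgroup H.
Proof.
move=> [] /set_mem H1 HF.
have HV x : H x -> H x^-1.
  by move=> Hx; rewrite -div1g; apply/set_mem/HF; apply/mem_set.
split=> // x y Hx Hy; rewrite -(invgK y); apply/set_mem/HF; apply/mem_set => //.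
exact: HV.
Qed.

(** The factor group is described by cosets; this is the form used for
    extensions. *)
Lemma cyclic_factor_gen H N : subgroup N -> cyclic_factor H N ->
  exists2 t, H t & H `<=` prod_set (cyc t) N.
Proof.
move=> sN [t Ht cycHN]; exists t => // x Hx.
have Nx : coset_in x N x by exists 1; [exact: subg1 | rewrite mulg1].
have [n [eq_x|eq_x]] := cycHN x Hx; move: Nx; rewrite eq_x => -[u Nu <-].
  by exists (t ^+ n); [exact: cycX | exists u].
exists (t ^- n); last by exists u.
by apply: (subgV (cyc_subgroup t)); apply: cycX.
Qed.

(** The quotient is cyclic, hence abelian: with [x = p u] and [y = q v], where
    [p] and [q] commute, both [x y] and [y x] lie in the coset of [p q]. *)
Lemma cyclic_ext_commutator H N t x y : subgroup H -> subgroup N ->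
  normalises H N -> H t -> H `<=` prod_set (cyc t) N ->
  H x -> H y -> N [~ x, y].
Proof.
move=> sH sN nHN Ht Hcyc Hx Hy.
have [p tp [u Nu eq_x]] := Hcyc x Hx; have [q tq [v Nv eq_y]] := Hcyc y Hy.
have Hq : H q by apply: (cyc_sub sH Ht tq).
have Hp : H p by apply: (cyc_sub sH Ht tp).
have cpq : p * q = q * p.
  have [a [b ->]] := tp; have [c [d ->]] := tq.
  have comX m n : commute (t ^+ m) (t ^+ n) by apply: commuteX2.
  have comp m : commute (t ^+ a * t ^- b) (t ^+ m).
    by apply/commute_sym/commuteM; [|apply: commuteV].
  by apply: commuteM; [|apply: commuteV]; apply: comp.
have -> : [~ x, y] = (v ^ p * u)^-1 * (u ^ q * v).
  apply: (mulgI (y * x)); rewrite -commgC -eq_x -eq_y.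
  have -> : p * u * (q * v) = p * q * (u ^ q * v) by rewrite !conjgE !mulgA mulgK.
  have -> : q * v * (p * u) = q * p * (v ^ p * u) by rewrite !conjgE !mulgA mulgK.
  by rewrite cpq -[RHS]mulgA mulVKg.
apply: subgM => //; last by apply: subgM => //; apply: nHN.
by apply: subgV => //; apply: subgM => //; apply: nHN.
Qed.

Lemma polycyclic_tame_solvable : polycyclic G ->
  tame [set: G] /\ exists n, dseries n `<=` [set 1].
Proof.
move=> [n [S [S0 Sn Sg Scyc]]].
have sS i : i <= n -> subgroup (S i) by move=> /Sg; apply: group_closed_subgroup.
split.
  suff down k : k <= n -> tame (S (n - k)) by rewrite -S0 -(subnn n); apply: down.
  elim: k => [|k IHk] lt_kn; first by rewrite subn0 Sn; exact: tame1.
  have lt_in : n - k.+1 < n by rewrite ltn_subrL (leq_ltn_trans _ lt_kn).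
  have [nSS cSS] := Scyc _ lt_in; rewrite subnSK // in nSS cSS.
  have [|t St cyct] := cyclic_factor_gen _ cSS; first exact: (sS _ (leq_subr _ _)).
  apply: (tame_cyclic_ext _ _ _ St cyct); last by apply: IHk; apply: ltnW.
  - exact: (sS _ (leq_subr _ _)).
  - by case: nSS.
  - by case: nSS.
exists n; rewrite -Sn; suff: forall i, i <= n -> dseries i `<=` S i by apply.
elim=> [|i IHi] lt_in; first by rewrite S0.
have [[_ nSS] cSS] := Scyc _ lt_in.
have [t St cyct] := cyclic_factor_gen (sS _ lt_in) cSS.
apply: derived_sub => [|y z /(IHi (ltnW lt_in)) Sy /(IHi (ltnW lt_in)) Sz].
  exact: sS.
exact: (cyclic_ext_commutator (sS _ (ltnW lt_in)) (sS _ lt_in) nSS St cyct).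
Qed.

End Derived.

(** * Finite quotients *)

(** The elements of the quotient are canonical coset representatives: [c x] is
    the first entry of the covering list in the coset of [x]. *)
Lemma finite_quotient (G : groupType) (N : set G) :
  subgroup N -> normalises [set: G] N -> fin_index N [set: G] ->
  exists (K : finGroupType) (F : UMagmaMorphism.type G K),
    (forall k, exists x, F x = k) /\ forall x, F x = 1 <-> N x.
Proof.
move=> sN nN [s [_ scov]].
pose R x : pred G := fun y => `[<N (x * y^-1)>].
have Rs x : has (R x) s.
  by have [//|y ys Nxy] := scov x; apply/hasP; exists y => //; apply/asboolP.
pose c x := nth 1 s (find (R x) s).
have cP x : N (x * (c x)^-1) by apply/asboolP; exact: (nth_find 1 (Rs x)).
have cE x y : c x = c y <-> N (x * y^-1).
  split=> [eq_c|Nxy].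
    rewrite -(mulgKA (c x)^-1) [in X in _ * X^-1]eq_c.
    by apply: subgM => //; apply: subgV.
  suff eqR : R x =1 R y by rewrite /c (eq_find eqR).
  by move=> z; apply: asbool_equiv_eq; rewrite -(divgKA y x z^-1) (subgMl _ sN Nxy).
have ccx x : c (c x) = c x.
  by apply/cE; rewrite -invgF; apply: subgV => //; exact: cP.
have cs x : c x \in map c s.
  by rewrite -ccx map_f // mem_nth // -has_find.
pose T := seq_sub (map c s); pose F x : T := SeqSub (cs x).
have FE x y : F x = F y <-> N (x * y^-1).
  by rewrite -cE; split=> [[]//|eq_c]; apply: val_inj.
have vF x : F (ssval (F x)) = F x by apply/FE; rewrite -invgF; apply: subgV => //; exact: cP.
have Fv k : F (ssval k) = k.
  by case: k => _y ys; apply: val_inj => /=; have /mapP[z _ ->] := ys.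
have FM x x' y y' : F x = F x' -> F y = F y' -> F (x * y) = F (x' * y').
  move=> /FE Nx /FE Ny; apply/FE.
  have -> : x * y * (x' * y')^-1 = (y * y'^-1) ^ x^-1 * (x * x'^-1).
    by rewrite conjgE invgK invgM !mulgA mulgVK.
  by apply: subgM => //; apply: nN.
pose mulT (a b : T) := F (ssval a * ssval b).
pose invT (a : T) := F (ssval a)^-1.
have mulTA : associative mulT.
  move=> a b d; rewrite /mulT; apply: etrans (_ : F (ssval a * (ssval b * ssval d)) = _).
    exact: FM.
  by rewrite mulgA; apply: FM.
have mul1T : left_id (F 1) mulT.
  by move=> a; rewrite /mulT -[RHS]Fv -[in RHS](mul1g (ssval a)); apply: FM.
have mulVT : left_inverse (F 1) invT mulT.
  by move=> a; rewrite /mulT -(mulVg (ssval a)); apply: FM.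
pose K : finGroupType := HB.pack T (Finite_isGroup.Build T mulTA mul1T mulVT).
have Fmorph : monoid_morphism (F : G -> K).
  by split=> // x y; apply: FM; rewrite vF.
pose FK : UMagmaMorphism.type G K :=
  HB.pack (F : G -> K) (isUMagmaMorphism.Build G K (F : G -> K) Fmorph).
exists K, FK; split=> [k|x]; first by exists (ssval (k : T)); exact: Fv.
by rewrite -(mulg1 x) -[in N _]invg1 -FE mulg1.
Qed.

(** * The Lang map along the derived series *)

(** The orbit map of 1 for twisted conjugation; its image is the twisted class
    of 1.  It is locked because rewriting with group laws would otherwise see
    through it as a product. *)
HB.lock Definition lang_map (G : groupType) (phi : G -> G) (g : G) : G :=
  g * phi g^-1.

Section Twisted.

Variables (G : groupType) (phi : UMagmaMorphism.type G G).
Implicit Types (A B C D N : set G) (a b g h x y z : G).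

Local Notation V n := (pow n [set: G]).

Local Notation delta := (lang_map phi).

Lemma lang_mapE g : delta g = g * phi g^-1.
Proof. by rewrite unlock. Qed.

Lemma twistE g x : g * x * phi g^-1 = x ^ g^-1 * delta g.
Proof. by rewrite !lang_mapE conjgE invgK !mulgA mulgVK. Qed.

(** The Lang map is a crossed homomorphism; modulo a subgroup where
    conjugation acts trivially it is a homomorphism. *)
Lemma lang_mapM g h : delta (g * h) = delta g * delta h ^ phi g^-1.
Proof. by rewrite !lang_mapE conjgE invgM gmulfM !gmulfV !invgK !mulgA mulgVK. Qed.

Lemma lang_map1 : delta 1 = 1.
Proof. by rewrite !lang_mapE invg1 gmulf1 mulg1. Qed.

(** The [h] with [delta h] in a normal subgroup [D] are those whose image in
    [G / D] is fixed by [phi]. *)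
Definition finite_fixed D : Prop :=
  finite_mod [set h | D (delta h)] (fun x y => D (y * x^-1)).

(** The Lang map of [G / D] is open at 1: the image of every neighbourhood
    [V k] of 1 contains a neighbourhood [V n]. *)
Definition open_orbits D : Prop := forall k, 0 < k -> exists2 n, 0 < n &
  forall x, V n x -> exists h a, [/\ V k h, D a & x = delta h * a].

Hypothesis tameG : tame [set: G].
Hypothesis fin_classes :
  finite_mod [set: G] (fun y x => exists g, x = g * y * phi g^-1).

Lemma V_subgroup n : subgroup (V n). Proof. exact: pow_subgroup. Qed.

Lemma V_normal n : normalises [set: G] (V n). Proof. exact: pow_normal. Qed.

(** Exponents can be multiplied, so finitely many elements are separated from
    [C] at once. *)
Lemma separable_list C (s : seq G) : subgroup C -> (forall x, x \in s -> ~ C x) ->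
  exists2 n, 0 < n & forall x, x \in s -> ~ prod_set C (V n) x.
Proof.
move=> sC; have [_ _ sepG] := tameG.
elim: s => [|x s IHs] nCs; first by exists 1%N.
have [n n0 nP] := IHs (fun y ys => nCs y (mem_behead (s := x :: s) ys)).
have [m m0 mP] := sepG C x sC (fun _ _ => I) I (nCs x (mem_head _ _)).
exists (n * m)%N; first by rewrite muln_gt0 n0.
move=> y; rewrite inE => /orP[/eqP -> | ys] [c Cc [v Vv eq_y]].
  by apply: mP; exists c => //; exists v => //; apply: pow_mull Vv.
by apply: (nP y ys); exists c => //; exists v => //; apply: pow_mulr Vv.
Qed.

(** A class of [G] splits into finitely many classes of the finite index
    subgroup [V k]. *)
Lemma fin_classes_pow k : 0 < k ->
  finite_mod [set: G] (fun y x => exists2 h, V k h & x = h * y * phi h^-1).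
Proof.
move=> k0; have [_ finV _] := tameG; have sV := V_subgroup k.
apply: (finite_mod_refine fin_classes) => y _.
have [s [_ scov]] := finV k k0.
apply: (@finite_mod_key _ _ s _ (fun z x =>
   exists2 h, V k h & x = h * (z * y * phi z^-1) * phi h^-1)) => [x [_ [g ->]]|].
  have [z zs Vgz] := scov g I; exists z => //; exists (g * z^-1) => //.
  by rewrite invgM invgK gmulfM !gmulfV !mulgA !mulgVK.
move=> z x x' _ _ _ [h Vh ->] [h' Vh' ->].
exists (h' * h^-1); first by apply: subgM => //; apply: subgV.
by rewrite invgM invgK gmulfM !gmulfV !mulgA !mulgVK.
Qed.

(** [A] and [C] stand for consecutive terms of the derived series, with [A / C]
    abelian. *)
Section Step.

Variables (A C : set G).
Hypotheses (sA : subgroup A) (sC : subgroup C) (CA : C `<=` A).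
Hypotheses (nA : normalises [set: G] A) (nC : normalises [set: G] C).
Hypothesis RAC : forall x y, A x -> A y -> C [~ x, y].
Hypotheses (phiA : forall x, A x -> A (phi x)) (phiC : forall x, C x -> C (phi x)).

(** The preimage in [A] of the image of [A :&: V k] under the Lang map of
    [A / C]. *)
Definition lang_image k : set G := prod_set [set delta b | b in A `&` V k] C.

Lemma lang_map_in a : A a -> A (delta a).
Proof. by move=> Aa; rewrite lang_mapE; apply: subgM => //; apply: phiA; apply: subgV. Qed.

Lemma lang_mapMC a b : A a -> A b ->
  exists2 c, C c & delta (a * b) = delta a * delta b * c.
Proof.
move=> Aa Ab; exists [~ delta b, phi a^-1].
  by apply: RAC; [exact: lang_map_in | apply: phiA; apply: subgV].
by rewrite lang_mapM commgEl -mulgA mulVKg.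
Qed.

Lemma lang_image_subgroup k : subgroup (lang_image k).
Proof.
have sV := V_subgroup k; split.
- exists 1; last by exists 1; rewrite ?mulg1 //; apply: subg1.
  by exists 1; [split; apply: subg1 | exact: lang_map1].
- move=> _ _ [_ [a [Aa Va] <-] [c Cc <-]] [_ [b [Ab Vb] <-] [d Cd <-]].
  have [e Ce eq_ab] := lang_mapMC Aa Ab.
  exists (delta (a * b)); first by exists (a * b) => //; split; apply: subgM.
  exists (e^-1 * (c ^ delta b * d)).
    by apply: subgM => //; [apply: subgV | apply: subgM => //; apply: nC].
  by rewrite eq_ab conjgE !mulgA !mulgK.
- move=> _ [_ [a [Aa Va] <-] [c Cc <-]].
  have [e Ce] := lang_mapMC Aa (subgV sA Aa); rewrite mulgV lang_map1 => eq_a.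
  exists (delta a^-1); first by exists a^-1 => //; split; apply: subgV.
  exists (e * c^-1 ^ (delta a)^-1).
    by apply: subgM => //; apply: nC => //; apply: subgV.
  have -> : delta a^-1 = (delta a)^-1 * e^-1.
    by apply: (mulgI (delta a)); apply: (mulIg e); rewrite -eq_a mulVKg mulVg.
  by rewrite conjgE invgK invgM !mulgA mulgVK mulVg mul1g.
Qed.

(** If [x] and [x'] in [A] lie in the class of [a \in A] under [V k], by means of
    [h] and [h'], then [h] and [h'] represent fixed points of [G / A].  When
    these coincide, [b = h' h^-1] is in [A :&: V k] and carries [x] to [x'], and
    [b x phi(b)^-1 = delta b * x] modulo [C]. *)
Lemma fin_index_lang_image k : 0 < k -> finite_fixed A ->
  fin_index (lang_image k) A.
Proof.
move=> k0 [t [tA tcov]]; have sV := V_subgroup k.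
have finA : finite_mod A (fun y x => exists2 h, V k h & x = h * y * phi h^-1).
  have [s [_ scov]] := fin_classes_pow k0.
  apply: (@finite_mod_key _ _ s _
    (fun y x => exists2 h, V k h & x = h * y * phi h^-1)) => [x _|]; first exact: scov.
  move=> y x x' _ _ _ [h Vh ->] [h' Vh' ->].
  exists (h' * h^-1); first by apply: subgM => //; apply: subgV.
  by rewrite invgM invgK gmulfM !gmulfV !mulgA !mulgVK.
apply: (finite_mod_refine finA) => a Aa.
apply: (@finite_mod_key _ _ t _ (fun z x =>
   exists h, [/\ V k h, x = h * a * phi h^-1 & A (h * z^-1)])).
  move=> x [Ax [h Vh eq_x]]; have [|z zt Ahz] := tcov h; last by exists z => //; exists h.
  move: Ax; rewrite eq_x twistE subgMl //; exact: nA.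
move=> z x x' _ [Ax _] _ [h [Vh eq_x Ahz]] [h' [Vh' eq_x' Ahz']].
pose b := h' * h^-1.
have Ab : A b.
  by rewrite /b -(mulgKA z^-1); apply: subgM => //; apply: subgV.
have Vb : V k b by apply: subgM => //; apply: subgV.
exists (delta b); first by exists b.
exists ([~ x, phi b^-1] ^ x^-1).
  by apply: nC => //; apply: RAC => //; apply: phiA; apply: subgV.
have -> : x' = b * x * phi b^-1.
  by rewrite eq_x' eq_x /b invgM invgK gmulfM !gmulfV !mulgA !mulgVK.
by rewrite lang_mapE commgEl !conjgE !invgK !mulgA !mulgK.
Qed.

(** Let [m] be the number of cosets of [lang_image 1] in [A].  Given elements of
    the kernel that are pairwise distinct modulo [C], separate them in a finite
    quotient [G / (C V n)].  There [A] becomes a finite abelian group on which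
    the Lang map is an endomorphism [psi], and the order of the kernel of [psi]
    is the index of its image, at most [m]. *)
Lemma lang_kernel_finite : fin_index (lang_image 1) A ->
  finite_mod [set a | A a /\ C (delta a)] (fun x y => C (y * x^-1)).
Proof.
move=> [t [tA tcov]]; apply: (@finite_mod_bounded _ _ _ (size t)) => s sP pws.
pose l := [seq u <- [seq x * y^-1 | x <- s, y <- s] | `[< ~ C u >]].
have [|n n0 nP] := @separable_list C l sC.
  by move=> u; rewrite mem_filter => /andP[/asboolP].
have sV := V_subgroup n.
pose N := prod_set C (V n).
have sN : subgroup N by apply: subgroup_prod => // c v _; apply: V_normal.
have nN : normalises [set: G] N.
  move=> h _ _ [c Cc [v Vv <-]]; exists (c ^ h); first exact: nC.
  by exists (v ^ h); [exact: V_normal | rewrite conjMg].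
have phiN x : N x -> N (phi x).
  move=> [c Cc [v Vv <-]]; exists (phi c); first exact: phiC.
  by exists (phi v); [exact: pow_hom Vv | rewrite gmulfM].
have CN : C `<=` N by move=> c; apply: prod_setl.
have finN : fin_index N [set: G].
  have [_ finV _] := tameG; apply: fin_indexS (finV n n0) => v; exact: prod_setr.
have [K [F [Fsurj Fker]]] := finite_quotient sN nN finN.
have FE x y : F x = F y <-> N (x * y^-1).
  by rewrite -Fker gmulfM gmulfV; split=> [->|/divg1_eq //]; rewrite mulgV.
have Fdelta a b : A a -> A b -> F (delta (a * b)) = F (delta a) * F (delta b).
  move=> Aa Ab; have [c Cc ->] := lang_mapMC Aa Ab.
  by rewrite gmulfM gmulfM (_ : F c = 1) ?mulg1 //; apply/Fker/CN.
pose FA : {set K} := finset (fun k => `[< exists2 a, A a & F a = k >]).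
have FAP k : reflect (exists2 a, A a & F a = k) (k \in FA).
  by rewrite inE; apply: asboolP.
have gFA : group_set FA.
  apply/group_setP; split; first by apply/FAP; exists 1; [exact: subg1 | rewrite gmulf1].
  move=> _ _ /FAP[a Aa <-] /FAP[b Ab <-].
  by apply/FAP; exists (a * b); [exact: subgM | rewrite gmulfM].
pose GA := Group gFA.
(* [psi] is defined through representatives [r k] in [A]; [psiE] shows that it
   does not depend on them. *)
have /choice[r rP] : forall k, exists a, k \in FA -> A a /\ F a = k.
  by move=> k; have [/FAP[a]|] := boolP (k \in FA); [exists a | exists 1].
pose psi k := F (delta (r k)).
have psiE a : A a -> psi (F a) = F (delta a).
  move=> Aa; have [|Ar Fr] := rP (F a); first by apply/FAP; exists a.
  rewrite /psi -[in RHS](mulgVK (r (F a)) a) Fdelta //; last by apply: subgM => //; apply: subgV.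
  have : F (delta (a * (r (F a))^-1)) = 1.
    rewrite lang_mapE; apply/Fker; apply: subgM => //.
      by apply/Fker; rewrite gmulfF Fr mulgV.
    by apply: phiN; apply: subgV => //; apply/Fker; rewrite gmulfF Fr mulgV.
  by move=> ->; rewrite mul1g.
have psiM : {in GA &, {morph psi : x y / x * y}}.
  move=> _ _ /FAP[a Aa <-] /FAP[b Ab <-].
  by rewrite -gmulfM !psiE ?Fdelta //; apply: subgM.
pose psim := Morphism psiM.
have imGA : psim @* GA \subset GA.
  apply/fintype.subsetP => _ /morphimP[k _ /FAP[a Aa <-] ->] /=.
  by apply/FAP; exists (delta a); [exact: lang_map_in | rewrite psiE].
have card_ker : #|'ker psim| = #|GA : psim @* GA|.
  apply/eqP; rewrite -(eqn_pmul2l (cardG_gt0 (psim @* GA)%G)) Lagrange //.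
  by rewrite card_morphim finset.setIid mulnC Lagrange // subsetIl.
have le_index : #|GA : psim @* GA| <= size t.
  rewrite -(size_map (fun z => (psim @* GA) :* F z)).
  apply: leq_trans (card_size _); apply: subset_leq_card.
  apply/fintype.subsetP => _ /rcosetsP[_ /FAP[a Aa <-] ->].
  have [z zt [_ [b [Ab _] <-] [c Cc eq_az]]] := tcov a Aa.
  apply/mapP; exists z => //; apply/rcoset_eqP; rewrite mem_rcoset -gmulfF -eq_az.
  rewrite gmulfM (_ : F c = 1) ?mulg1; last by apply/Fker/CN.
  by rewrite -psiE //; apply: mem_morphim; apply/FAP; exists b.
apply: leq_trans le_index; rewrite -card_ker.
have us : uniq (map F s).
  rewrite uniq_pairwise pairwise_map; apply: sub_in_pairwise (allss s) pws => x y xs ys.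
  move=> /asboolP nCxy; apply/eqP => /FE; apply: nP.
  rewrite mem_filter; apply/andP; split; first exact/asboolP.
  by apply/allpairsP; exists (x, y).
rewrite -(size_map F) -(card_uniqP us); apply: subset_leq_card.
apply/fintype.subsetP => _ /mapP[a /sP[Aa Cda] ->].
apply/kerP; first by apply/FAP; exists a.
by rewrite /= psiE //; apply/Fker/CN.
Qed.

(** A fixed point of [G / C] lies over one of the finitely many fixed points of
    [G / A], and two over the same one differ by an element of [A] whose Lang
    map is in [C]. *)
Lemma finite_fixed_step : finite_fixed A -> finite_fixed C.
Proof.
move=> fixA; have [t [tZ tcov]] := lang_kernel_finite (fin_index_lang_image (ltn0Sn 0) fixA).
have fixCA : finite_mod [set h | C (delta h)] (fun x y => A (y * x^-1)).
  have [s [_ scov]] := fixA.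
  apply: (@finite_mod_key _ _ s _ (fun x y => A (y * x^-1))).
    by move=> h Ch; apply: scov; apply: CA.
  move=> z x y _ _ _ Ax Ay; rewrite -(mulgKA z^-1).
  by apply: subgM => //; apply: subgV.
apply: (finite_mod_refine fixCA) => y Cy.
apply: (@finite_mod_key _ _ t _ (fun z x => C (x * (z * y)^-1))).
  move=> x [Cx Axy]; have [|z zt Cz] := tcov (x * y^-1).
    split=> //; have: C (delta (x * y^-1 * y)) by rewrite mulgVK.
    by rewrite lang_mapM (subgMr _ sC) //; apply: nC.
  by exists z => //; rewrite invgM mulgA.
move=> z x x' _ _ _ Cx Cx'; rewrite -(mulgKA (z * y)^-1).
by apply: subgM => //; apply: subgV.
Qed.

(** Separability makes [lang_image k] open in [A]: some [V m] meets [A] inside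
    it.  Write [x = delta h * a] with [h] and [x], hence [a], in [V (m * k)]; a
    conjugate of [a] is then [delta b] modulo [C], with [b \in V k], and the
    conjugation is the one that makes [delta (h * b)] equal to [x] modulo
    [C]. *)
Lemma open_orbits_step : finite_fixed A -> open_orbits A -> open_orbits C.
Proof.
move=> fixA openA k k0; have [t [_ tcov]] := fin_index_lang_image k0 fixA.
have sB := lang_image_subgroup k.
have [|m m0 mP] := @separable_list (lang_image k) [seq z <- t | `[< ~ lang_image k z >]] sB.
  by move=> z; rewrite mem_filter => /andP[/asboolP].
have VB x : V m x -> A x -> lang_image k x.
  move=> Vx Ax; have [z zt Bxz] := tcov x Ax.
  have [Bz|nBz] := pselect (lang_image k z).
    by rewrite -(mulgVK z x); apply: subgM.
  case: (mP z); first by rewrite mem_filter zt andbT; apply/asboolP.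
  exists (x * z^-1)^-1; first exact: subgV.
  by exists x => //; rewrite invgM invgK mulgVK.
have mk0 : 0 < (m * k)%N by rewrite muln_gt0 m0.
have [n n0 nP] := openA _ mk0.
have sV := V_subgroup (m * k)%N.
exists (n * (m * k))%N => [|x Vx]; first by rewrite muln_gt0 n0.
have [h [a [Vh Aa eq_x]]] := nP x (pow_mulr Vx).
have Va : V (m * k)%N a.
  have Vdh : V (m * k)%N (delta h).
    by rewrite lang_mapE; apply: subgM => //; apply: pow_hom (subgV sV Vh).
  by rewrite -(subgMl _ sV Vdh) -eq_x; apply: pow_mull Vx.
have [||_ [b [Ab Vb] <-] [c Cc eq_a]] := VB (a ^ (phi h^-1)^-1).
- by apply: V_normal => //; apply: pow_mulr Va.
- by apply: nA.
exists (h * b), (c ^ phi h^-1); split.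
- by apply: (subgM (V_subgroup k)) => //; apply: pow_mull Vh.
- by apply: nC.
- by rewrite lang_mapM -mulgA -conjMg eq_a conjgKV.
Qed.

End Step.

Lemma lang_image_open n : dseries n `<=` [set 1 : G] ->
  exists2 m, 0 < m & forall x, V m x -> exists h, x = delta h.
Proof.
move=> Dn1.
suff: finite_fixed (dseries n) /\ open_orbits (dseries n).
  case=> _ /(_ 1%N isT)[m m0 mP]; exists m => // x /mP[h [a [_ /Dn1 -> ->]]].
  by exists h; rewrite mulg1.
elim: n {Dn1} => [|j [IHfix IHopen]].
  split=> [|k k0]; first by exists [:: 1]; split=> // x _; exists 1; rewrite ?mem_head.
  exists 1%N => // x _; exists 1, x.
  by rewrite lang_map1 mul1g; split=> //; apply: (subg1 (V_subgroup k)).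
have sA := @dseries_subgroup G j; have sC := @dseries_subgroup G j.+1.
have CA := @dseriesS G j; have RAC := @dseriesR G j.
have nA := @dseries_normal G j; have nC := @dseries_normal G j.+1.
have phiA := @dseries_hom G phi j; have phiC := @dseries_hom G phi j.+1.
split; first exact: (finite_fixed_step sA).
exact: (open_orbits_step sA).
Qed.

End Twisted.

(** * Twisted conjugacy classes are periodic *)
Lemma finite_Reidemeister_mod (G : groupType) (phi : UMagmaMorphism.type G G) :
  finite_Reidemeister phi ->
  finite_mod [set: G] (fun y x => exists g, x = g * y * phi g^-1).
Proof.
move=> /(@finite_seqP (set G))[s eq_s].
apply: (@finite_mod_key _ _ s _ (fun C x => C = twisted_class phi x)).
  move=> x _; exists (twisted_class phi x) => //.
  by have : [set` s] (twisted_class phi x) by rewrite -eq_s; exists x.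
move=> _ x x' _ _ _ -> eq_class.
suff: twisted_class phi x x' by [].
by rewrite eq_class; exists 1; rewrite invg1 gmulf1 mul1g mulg1.
Qed.

(** [psi] below is [phi] followed by conjugation by [x0^-1]; right translation
    by [x0] carries the classes of [psi] to those of [phi], so [psi] has
    finitely many classes as well.  Normality of [pow n] lets the saturation of
    the class at [x0] propagate to its other elements. *)
Lemma twisted_class_saturated (G : groupType) (phi : UMagmaMorphism.type G G)
    (x0 : G) :
  polycyclic G -> finite_Reidemeister phi ->
  exists2 n, 0 < n & forall v x, pow n [set: G] v ->
    twisted_class phi x0 x -> twisted_class phi x0 (v * x).
Proof.
move=> /polycyclic_tame_solvable[tameG [k Dk1]] /finite_Reidemeister_mod finR.
pose psi : UMagmaMorphism.type G G := conj_by x0^-1 \o phi.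
have psiE g : psi g = x0 * phi g * x0^-1 by rewrite /= /conj_by conjgE invgK mulgA.
have finR' : finite_mod [set: G] (fun y x => exists g, x = g * y * psi g^-1).
  have [s [_ scov]] := finR.
  apply: (@finite_mod_key _ _ s _
    (fun y x => exists g, x * x0 = g * y * phi g^-1)) => [x _|]; first exact: scov.
  move=> y x x' _ _ _ [g eq_x] [h eq_x'].
  exists (h * g^-1); rewrite psiE -{1}(mulgK x0 x) eq_x -{1}(mulgK x0 x') eq_x'.
  by rewrite invgM invgK gmulfM !gmulfV !mulgA !mulgVK.
have [n n0 nP] := lang_image_open tameG finR' Dk1.
exists n => // v _ Vv [g ->].
have [h] := nP (v ^ g) (V_normal I Vv).
rewrite lang_mapE psiE => eq_vg; exists (g * h).
have -> : v * (g * x0 * phi g^-1) = g * (v ^ g) * x0 * phi g^-1.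
  by rewrite conjgE !mulgA mulgV mul1g.
by rewrite eq_vg invgM gmulfM !mulgA mulgVK.
Qed.

(** The induced endomorphism is onto because [phi] is, hence bijective because
    [K] is finite. *)
Lemma induced_automorphism (G : groupType) (K : finGroupType)
    (phi : UMagmaMorphism.type G G) (F : UMagmaMorphism.type G K) :
  bijective phi -> (forall k, exists x, F x = k) ->
  (forall x, F x = 1 -> F (phi x) = 1) ->
  exists phiK : UMagmaMorphism.type K K,
    bijective phiK /\ F \o phi =1 phiK \o F.
Proof.
move=> [phi' _ phiK] /choice[r rK] kerF.
pose f k := F (phi (r k)).
have fE x : f (F x) = F (phi x).
  apply: divg1_eq; rewrite -gmulfF -gmulfF; apply: kerF.
  by rewrite gmulfF rK mulgV.
have f_morph : monoid_morphism f.
  split=> [|k l]; first by have := fE 1; rewrite !gmulf1.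
  by rewrite -(rK k) -(rK l) -gmulfM !fE !gmulfM.
pose fK : UMagmaMorphism.type K K :=
  HB.pack f (isUMagmaMorphism.Build K K f f_morph).
exists fK; split; last by move=> x /=; rewrite fE.
pose g k := F (phi' (r k)).
have gK : cancel g f by move=> k; rewrite /g fE phiK rK.
exact: (bij_can_bij (injF_bij (can_inj gK)) (gK : cancel g fK)).
Qed.

Theorem theorem4p2 (G : groupType) (polyG : polycyclic G) : RP_group G.
Proof.
move=> phi0 bij_phi finR _ [x0 _ <-].
(* [{multiplicative G -> G}] does not record that 1 is preserved. *)
have phi0_morph : monoid_morphism phi0.
  by split; [apply: (mulgI (phi0 1)); rewrite -gmulfM !mulg1 | exact: gmulfM].
pose phi : UMagmaMorphism.type G G :=
  HB.pack (phi0 : G -> G) (isUMagmaMorphism.Build G G phi0 phi0_morph).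
have [n n0 satC] := @twisted_class_saturated G phi x0 polyG finR.
have [[_ finV _] _] := polycyclic_tame_solvable polyG.
have sV := pow_subgroup n [set: G].
have [K [F [Fsurj Fker]]] := finite_quotient sV (@V_normal G n) (finV n n0).
have [phiK [bij_phiK FphiK]] : exists phiK : UMagmaMorphism.type K K,
    bijective phiK /\ F \o phi =1 phiK \o F.
  apply: induced_automorphism => // x /Fker Vx; apply/Fker.
  exact: pow_hom Vx.
pose FC : {set K} := finset (fun k => `[< exists2 x, twisted_class phi x0 x & F x = k >]).
exists K, phiK, F, FC; split=> //.
  by apply/seteqP; split=> // k _; have [x <-] := Fsurj k; exists x.
move=> x /=; rewrite inE; apply/idP/asboolP => [/set_mem Cx|[y Cy eqF]].
  by exists x.
apply/mem_set; rewrite -(mulgVK y x); apply: satC => //; apply/Fker.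
by rewrite gmulfF eqF mulgV.
Qed.
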